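(* Suppose $S:\mathbb{R}^n\rightrightarrows\mathbb{R}^m$ is locally closed at $(\bar x,\bar y)\in\mathrm{gph}(S)$ and has the Aubin property there. Then the convexified coderivative $\mathrm{cl}\,\mathrm{co}\,D^{*}S(\bar x\mid\bar y):\mathbb{R}^m\rightrightarrows\mathbb{R}^n$ is uniquely determined by the set of all prefans $H:\mathbb{R}^n\rightrightarrows\mathbb{R}^m$ such that $S$ is pseudo strictly $H$-differentiable at $(\bar x,\bar y)$. That is: if $S_1,S_2:\mathbb{R}^n\rightrightarrows\mathbb{R}^m$ are such that, for $i=1,2$, $S_i$ is locally closed at $(\bar x_i,\bar y_i)\in\mathrm{gph}(S_i)$ and has the Aubin property there, and if for every prefan $H:\mathbb{R}^n\rightrightarrows\mathbb{R}^m$ the map $S_1$ is pseudo strictly $H$-differentiable at $(\bar x_1,\bar y_1)$ if and only if $S_2$ is pseudo strictly $H$-differentiable at $(\bar x_2,\bar y_2)$, then $\mathrm{cl}\,\mathrm{co}\,D^{*}S_1(\bar x_1\mid\bar y_1)(u)=\mathrm{cl}\,\mathrm{co}\,D^{*}S_2(\bar x_2\mid\bar y_2)(u)$ for all $u\in\mathbb{R}^m$.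
   Context: A set-valued map $S:\mathbb{R}^n\rightrightarrows\mathbb{R}^m$ assigns to each $x$ a subset $S(x)\subset\mathbb{R}^m$ (possibly empty); its graph is $\mathrm{gph}(S)=\{(x,y)\mid y\in S(x)\}$. $S$ is locally closed at $(\bar x,\bar y)\in\mathrm{gph}(S)$ if $\mathrm{gph}(S)\cap\mathbb{B}_\epsilon((\bar x,\bar y))$ is closed for some $\epsilon>0$, where $\mathbb{B}_\epsilon(z)$ is the closed ball of radius $\epsilon$ centered at $z$; $\mathbb{B}$ is the closed unit ball. Norms are Euclidean. $H:\mathbb{R}^n\rightrightarrows\mathbb{R}^m$ is positively homogeneous if $0\in H(0)$ and $H(kw)=kH(w)$ for all $k>0$, $w\in\mathbb{R}^n$. For a real $\delta>0$, $(H+\delta)(w):=H(w)+\delta\|w\|\mathbb{B}$. $H$ is a prefan if it is positively homogeneous, $H(p)$ is nonempty, convex and compact for all $p$, and $\|H\|^{+}:=\sup_{\|w\|\le1}\sup_{z\in H(w)}\|z\|$ is finite. $S$ is pseudo strictly $H$-differentiable at $(\bar x,\bar y)\in\mathrm{gph}(S)$ if for any $\delta>0$ there are neighborhoods $U_\delta$ of $\bar x$ and $V_\delta$ of $\bar y$ such that $S(x)\cap V_\delta\subset S(x')+(H+\delta)(x-x')$ for all $x,x'\in U_\delta$. $S$ has the Aubin property at $(\bar x,\bar y)$ if it is pseudo strictly $H$-differentiable there for some $H$ of the form $H(w)=\kappa\|w\|\mathbb{B}$ with $\kappa\ge0$. For $C\subset\mathbb{R}^N$ and $\bar z\in C$,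 the regular normal cone is $\hat N_C(\bar z)=\{w\mid\langle w,z-\bar z\rangle\le o(\|z-\bar z\|)\text{ for all }z\in C\}$, and the limiting normal cone is $N_C(\bar z)=\{w\mid\exists z_i\to\bar z,\ z_i\in C,\ w_i\in\hat N_C(z_i),\ w_i\to w\}$. The limiting coderivative $D^{*}S(\bar x\mid\bar y):\mathbb{R}^m\rightrightarrows\mathbb{R}^n$ is defined by $v\in D^{*}S(\bar x\mid\bar y)(u)\iff(v,-u)\in N_{\mathrm{gph}(S)}(\bar x,\bar y)$. The convexified coderivative $\mathrm{cl}\,\mathrm{co}\,D^{*}S(\bar x\mid\bar y)$ maps $u$ to the closed convex hull of $D^{*}S(\bar x\mid\bar y)(u)$. *)

(* Defs.v *)
From HB Require Import structures.
From mathcomp Require Import all_boot all_order all_algebra.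
From mathcomp Require Import all_classical all_reals all_analysis.

Set Implicit Arguments.
Unset Strict Implicit.
Unset Printing Implicit Defensive.

Import Order.TTheory GRing.Theory Num.Theory.
Import numFieldNormedType.Exports.

Local Open Scope classical_set_scope.
Local Open Scope ring_scope.

(* R^n is 'rV[R]_n.  The library norm `|x| on 'rV[R]_n is the max norm, so the
   Euclidean norm is defined here.  The library topology of 'rV[R]_n (nbhs,
   closed, compact, closure, -->) is the usual one, common to all norms. *)

Section euclidean.
Context {R : realType} {n : nat}.
Implicit Types (x y : 'rV[R]_n) (A B : set 'rV[R]_n).

Definition dotv x y : R := \sum_(i < n) x 0 i * y 0 i.

Definition enorm x : R := Num.sqrt (dotv x x).

Definition ecball x (r : R) : set 'rV[R]_n := [set y | enorm (y - x) <= r].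

Definition setadd A B : set 'rV[R]_n := [set a + b | a in A & b in B].

Definition setscale (k : R) A : set 'rV[R]_n := [set k *: a | a in A].

Definition clco A : set 'rV[R]_n :=
  closure (smallest [set B : set 'rV[R]_n | @convex_set R 'rV[R]_n B] A).

End euclidean.

Section set_valued_maps.
Context {R : realType} {n m : nat}.
Implicit Types (S H : 'rV[R]_n -> set 'rV[R]_m) (x : 'rV[R]_n) (y : 'rV[R]_m).

(* R^n x R^m is identified with R^(n+m), (x, y) being row_mx x y, so that the
   Euclidean norm on the product is the norm of R^(n+m). *)
Definition gph S : set 'rV[R]_(n + m) := [set z | S (lsubmx z) (rsubmx z)].

Definition locally_closed S x y : Prop :=
  exists2 eps : R, 0 < eps & closed (gph S `&` ecball (row_mx x y) eps).

Definition poshomogeneous H : Prop :=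
  H 0 0 /\ forall (k : R) (w : 'rV[R]_n), 0 < k -> H (k *: w) = setscale k (H w).

Definition addball H (delta : R) : 'rV[R]_n -> set 'rV[R]_m :=
  fun w => setadd (H w) (setscale (delta * enorm w) (ecball 0 1)).

Definition outer_norm H : \bar R :=
  ereal_sup [set ereal_sup [set (enorm z)%:E | z in H w]
            | w in [set w : 'rV[R]_n | enorm w <= 1]].

Definition prefan H : Prop :=
  [/\ poshomogeneous H,
      forall p, [/\ H p !=set0, @convex_set R 'rV[R]_m (H p) & compact (H p)] &
      outer_norm H \is a fin_num].

Definition pseudo_strict_diff S x y H : Prop :=
  forall delta : R, 0 < delta ->
  exists U : set 'rV[R]_n, exists V : set 'rV[R]_m,
  [/\ nbhs x U, nbhs y V &
      forall a b, U a -> U b ->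
        S a `&` V `<=` setadd (S b) (addball H delta (a - b))].

Definition aubin S x y : Prop :=
  exists2 kappa : R, 0 <= kappa &
  pseudo_strict_diff S x y (fun w => setscale (kappa * enorm w) (ecball 0 1)).

End set_valued_maps.

Section normal_cones.
Context {R : realType} {N : nat}.
Implicit Types (C : set 'rV[R]_N) (z : 'rV[R]_N).

Definition regular_normal C z : set 'rV[R]_N :=
  [set w | C z /\ forall eps : R, 0 < eps ->
    \forall z' \near z, C z' -> dotv w (z' - z) <= eps * enorm (z' - z)].

Definition limiting_normal C z : set 'rV[R]_N :=
  [set w | exists z_ : nat -> 'rV[R]_N, exists w_ : nat -> 'rV[R]_N,
    [/\ forall i, C (z_ i), forall i, regular_normal C (z_ i) (w_ i),
        z_ i @[i --> \oo] --> z & w_ i @[i --> \oo] --> w]].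

End normal_cones.

Definition coderivative {R : realType} {n m : nat}
    (S : 'rV[R]_n -> set 'rV[R]_m) (x : 'rV[R]_n) (y : 'rV[R]_m) :
    'rV[R]_m -> set 'rV[R]_n :=
  fun u => [set v | limiting_normal (gph S) (row_mx x y) (row_mx v (- u))].

Definition convexified_coderivative {R : realType} {n m : nat}
    (S : 'rV[R]_n -> set 'rV[R]_m) (x : 'rV[R]_n) (y : 'rV[R]_m) :
    'rV[R]_m -> set 'rV[R]_n :=
  fun u => clco (coderivative S x y u).

(* Main.v *)
Require Import Defs.
From HB Require Import structures.
From mathcomp Require Import all_boot all_order all_algebra.
From mathcomp Require Import all_classical all_reals all_analysis.
From mathcomp Require Import ring lra.

Import Order.TTheory GRing.Theory Num.Theory.
Import numFieldNormedType.Exports.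

Local Open Scope classical_set_scope.
Local Open Scope ring_scope.

(** Pseudo strict H-differentiability of S forces, for every regular normal
    (v, -u) to gph S near the reference point and every w, some h in H(w) with
    <u, h> <= <v, w> up to small errors.  Conversely, if for a fixed direction w0
    and a compact convex D every nearby regular normal admits h in D with
    <u, h> <= <v, w0>, then an Euler polygon in the directions (-w0, -D), steered
    by nearest points of gph S (proximal aiming), stays near gph S, and the Aubin
    property turns this into the inclusion
    S(x) /\ V c S(x - t w0) + t D + t delta B.

    Suppose v0 lies in D*S1(u0) but not in clco D*S2(u0), and separate:
    <v0, w0> < alpha < <v, w0> for all v in D*S2(u0).  Let H equal kappa|w|B off
    the ray of w0, and t (half-ball {<u0, h> >= alpha}) at t w0.  If the half-ball
    is large enough, S2 is pseudo strictly H-differentiable by the converse above,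
    while v0 shows that S1 is not. *)

(** * Euclidean inner product, norm and topology *)

Section euclidean_space.
Context {R : realType} {n : nat}.
Implicit Types (x y z : 'rV[R]_n) (A K : set 'rV[R]_n).

Lemma dotvC x y : dotv x y = dotv y x.
Proof. by apply: eq_bigr => i _; rewrite mulrC. Qed.

Lemma dotvDl x y z : dotv (x + y) z = dotv x z + dotv y z.
Proof. by rewrite -big_split; apply: eq_bigr => i _; rewrite mxE mulrDl. Qed.

Lemma dotvDr x y z : dotv z (x + y) = dotv z x + dotv z y.
Proof. by rewrite dotvC dotvDl !(dotvC z). Qed.

Lemma dotvZl (k : R) x y : dotv (k *: x) y = k * dotv x y.
Proof. by rewrite mulr_sumr; apply: eq_bigr => i _; rewrite mxE mulrA. Qed.

Lemma dotvZr (k : R) x y : dotv x (k *: y) = k * dotv x y.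
Proof. by rewrite dotvC dotvZl dotvC. Qed.

Lemma dotvNl x y : dotv (- x) y = - dotv x y.
Proof. by rewrite -scaleN1r dotvZl mulN1r. Qed.

Lemma dotvNr x y : dotv x (- y) = - dotv x y.
Proof. by rewrite dotvC dotvNl dotvC. Qed.

Lemma dotv0l x : dotv 0 x = 0.
Proof. by rewrite -(scale0r x) dotvZl mul0r. Qed.

Lemma dotv0r x : dotv x 0 = 0.
Proof. by rewrite dotvC dotv0l. Qed.

Definition dotvE := (dotvDl, dotvDr, dotvZl, dotvZr, dotvNl, dotvNr).

Lemma dotvv_ge0 x : 0 <= dotv x x.
Proof. by apply: sumr_ge0 => i _; rewrite -expr2 sqr_ge0. Qed.

Lemma enorm_ge0 x : 0 <= enorm x.
Proof. exact: sqrtr_ge0. Qed.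

Lemma enorm_sqr x : enorm x ^+ 2 = dotv x x.
Proof. by rewrite sqr_sqrtr // dotvv_ge0. Qed.

Lemma enorm0 : enorm (0 : 'rV[R]_n) = 0.
Proof. by rewrite /enorm dotv0l sqrtr0. Qed.

Lemma enormN x : enorm (- x) = enorm x.
Proof. by rewrite /enorm dotvNl dotvNr opprK. Qed.

Lemma enormB x y : enorm (x - y) = enorm (y - x).
Proof. by rewrite -opprB enormN. Qed.

Lemma enormZ (k : R) x : enorm (k *: x) = `|k| * enorm x.
Proof.
by rewrite /enorm dotvZl dotvZr mulrA -expr2 sqrtrM ?sqr_ge0 // sqrtr_sqr.
Qed.

Lemma enorm_eq0 x : enorm x = 0 -> x = 0.
Proof.
move=> x0; have /eqP : dotv x x = 0 by rewrite -enorm_sqr x0 expr0n.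
rewrite psumr_eq0 => [/allP h|i _]; last by rewrite -expr2 sqr_ge0.
apply/rowP => i; rewrite mxE; apply/eqP.
by have := h i (mem_index_enum i); rewrite -expr2 sqrf_eq0.
Qed.

Lemma enorm_gt0 x : x != 0 -> 0 < enorm x.
Proof.
move=> x0; rewrite lt_neqAle enorm_ge0 andbT eq_sym.
by apply: contra x0 => /eqP/enorm_eq0 ->.
Qed.

(** Cauchy-Schwarz: the vector [enorm y ^+ 2 *: x - dotv x y *: y] has a nonnegative square. *)
Lemma dotv_le x y : dotv x y <= enorm x * enorm y.
Proof.
have [->|y0] := eqVneq y 0; first by rewrite dotv0r enorm0 mulr0.
have yp := enorm_gt0 _ y0.
have := dotvv_ge0 (enorm y ^+ 2 *: x - dotv x y *: y).
rewrite !dotvE (dotvC y x) -!enorm_sqr => h.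
have {h} : 0 <= enorm y ^+ 2 * ((enorm x * enorm y) ^+ 2 - dotv x y ^+ 2).
  by apply: le_trans h _; rewrite le_eqVlt; apply/orP; left; apply/eqP; ring.
rewrite pmulr_rge0 ?exprn_gt0 // subr_ge0 => h.
have p : 0 <= enorm x * enorm y by rewrite mulr_ge0 // enorm_ge0.
have [d0|d0] := leP (dotv x y) 0; first exact: le_trans d0 p.
by rewrite -ler_sqr ?nnegrE // ltW.
Qed.

Lemma dotv_ge x y : - (enorm x * enorm y) <= dotv x y.
Proof. by rewrite lerNl -dotvNl (le_trans (dotv_le _ _)) // enormN. Qed.

Lemma enormD x y : enorm (x + y) <= enorm x + enorm y.
Proof.
rewrite -ler_sqr ?nnegrE ?addr_ge0 ?enorm_ge0 //.
rewrite enorm_sqr !dotvE (dotvC y x) -!enorm_sqr.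
by have := dotv_le x y; lra.
Qed.

Lemma enormDB x y z : enorm (x - z) <= enorm (x - y) + enorm (y - z).
Proof. by apply: le_trans (enormD _ _); rewrite addrA subrK. Qed.

Lemma normr_le_enorm x : `|x| <= enorm x.
Proof.
rewrite [leLHS]/Num.Def.normr /= mx_normrE bigmax_le ?enorm_ge0 // => -[i j] _ /=.
rewrite (ord1 i) -ler_sqr ?nnegrE ?enorm_ge0 // enorm_sqr real_normK ?num_real //.
rewrite /dotv (bigD1 j) //= -expr2 lerDl sumr_ge0 // => k _.
by rewrite -expr2 sqr_ge0.
Qed.

Lemma enorm_le_normr x : enorm x <= n%:R * `|x|.
Proof.
have h i : `|x 0 i| <= `|x|.
  by rewrite [leRHS]/Num.Def.normr /= mx_normrE; apply/bigmax_geP; right; exists (0, i).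
rewrite -ler_sqr ?nnegrE ?enorm_ge0 ?mulr_ge0 // enorm_sqr.
apply: (@le_trans _ _ (\sum_(i < n) `|x| ^+ 2)).
  by apply: ler_sum => i _; rewrite -expr2 -real_normK ?num_real // lerXn2r ?nnegrE.
rewrite sumr_const card_ord exprMn -[leLHS]mulr_natl ler_wpM2r ?sqr_ge0 //.
by rewrite -natrX ler_nat; case: (n) => // k; rewrite expnS leq_pmulr // expn1.
Qed.

(** The library topology comes from the max norm; the two preceding comparisons of norms make the
    Euclidean balls a basis of the same neighbourhoods. *)
Lemma nbhs_enormP x A :
  nbhs x A <-> exists2 r : R, 0 < r & forall y, enorm (y - x) < r -> A y.
Proof.
split=> [/nbhs_ballP[e /= e0 eA]|[r r0 rA]].
  exists e => // y yx; apply: eA; rewrite mx_norm_ball /ball_ /=.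
  by apply: le_lt_trans (normr_le_enorm _) _; rewrite enormB.
(* [n.+1] instead of [n] keeps the radius positive when [n = 0]. *)
apply/nbhs_ballP; exists (r / n.+1%:R); first by rewrite /= divr_gt0.
move=> y; rewrite mx_norm_ball /ball_ /= => xy; apply: rA; rewrite enormB.
apply: le_lt_trans (enorm_le_normr _) _.
move: xy; rewrite ltr_pdivlMr // mulrC; apply: le_lt_trans.
by rewrite ler_wpM2r // ler_nat.
Qed.

Lemma cvg_enormP (u : nat -> 'rV[R]_n) x :
  (forall i : nat, enorm (u i - x) < i.+1%:R^-1) -> u i @[i --> \oo] --> x.
Proof.
move=> h A /nbhs_enormP[r r0 rA].
have := near_infty_natSinv_lt (PosNum r0); apply: filterS => i /= ir.
by apply: rA; exact: lt_trans (h i) ir.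
Qed.

Lemma enormB_continuous z : continuous (fun x => enorm (x - z)).
Proof.
move=> x; apply/(@cvgrPdist_lt _ R^o _ (nbhs x)) => e e0.
apply/nbhs_enormP; exists e => // y xy.
have := enormDB x y z; have := enormDB y x z.
by rewrite ltr_norml (enormB x y); move: xy; lra.
Qed.

Lemma dotv_continuous z : continuous (dotv z).
Proof.
move=> x; apply/(@cvgrPdist_lt _ R^o _ (nbhs x)) => e e0.
have z1 : 0 < enorm z + 1 by rewrite ltr_pwDr ?enorm_ge0.
apply/nbhs_enormP; exists (e / (enorm z + 1)); first exact: divr_gt0.
move=> y; rewrite ltr_pdivlMr // => xy.
rewrite -dotvNr -dotvDr enormB in xy *.
have := dotv_le z (x - y); have := dotv_ge z (x - y).
by have := enorm_ge0 (x - y); rewrite ltr_norml; move: xy; nra.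
Qed.

Lemma closed_ecball x (r : R) : closed (ecball x r).
Proof.
have -> : ecball x r = (fun y => enorm (y - x)) @^-1` [set t | t <= r] by [].
by apply: closed_comp (@closed_le _ r) => y _; exact: enormB_continuous.
Qed.

Lemma compact_ecball x (r : R) : compact (ecball x r).
Proof.
apply: bounded_closed_compact; last exact: closed_ecball.
exists (r + enorm x); split; first exact: num_real.
move=> M rM y yx; apply: le_trans (normr_le_enorm _) _.
by have := enormD (y - x) x; rewrite subrK; move: yx rM; rewrite /ecball /=; lra.
Qed.

Lemma nearest_point K z : K !=set0 -> compact K ->
  exists2 p, K p & forall q, K q -> enorm (p - z) <= enorm (q - z).
Proof.
move=> K0 cK; have [|p pK hp] := @EVT_min_rV R n (fun q => enorm (q - z)) K K0 cK.
  by apply: continuous_subspaceT; exact: enormB_continuous.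
by exists p; [rewrite inE in pK|move=> q Kq; apply: hp; rewrite inE].
Qed.

Lemma convex_setP A : @convex_set R 'rV[R]_n A <->
  forall x y (t : R), A x -> A y -> 0 <= t <= 1 -> A (t *: x + (1 - t) *: y).
Proof.
split=> [cA x y t Ax Ay t01|cA x y t].
  have := cA x y (Itv01 (andP t01).1 (andP t01).2).
  by rewrite !inE; apply.
by rewrite !inE => Ax Ay; apply: cA => //; rewrite ge0 le1.
Qed.

Lemma convex_ecball x (r : R) : @convex_set R 'rV[R]_n (ecball x r).
Proof.
apply/convex_setP => a b t ha hb /andP[t0 t1]; rewrite /ecball /= in ha hb *.
have -> : t *: a + (1 - t) *: b - x = t *: (a - x) + (1 - t) *: (b - x).
  by rewrite !scalerBr addrACA -opprD -scalerDl addrC subrKC scale1r addrC.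
apply: le_trans (enormD _ _) _; rewrite !enormZ !ger0_norm ?subr_ge0 //.
have : t * enorm (a - x) <= t * r by rewrite ler_wpM2l.
have : (1 - t) * enorm (b - x) <= (1 - t) * r by rewrite ler_wpM2l // subr_ge0.
lra.
Qed.

End euclidean_space.

(** * Closed convex hulls and separation *)

Section closed_convex_sets.
Context {R : realType} {n : nat}.
Implicit Types (x y z : 'rV[R]_n) (A B C : set 'rV[R]_n).

Lemma closure_enormP A x :
  closure A x <-> forall r : R, 0 < r -> exists2 y, A y & enorm (y - x) < r.
Proof.
split=> [cAx r r0|h B /nbhs_enormP[r r0 rB]].
  have [|y [Ay yr]] := cAx [set y | enorm (y - x) < r]; last by exists y.
  by apply/nbhs_enormP; exists r.
by have [y Ay yr] := h r r0; exists y; split => //; exact: rB.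
Qed.

Lemma convex_closure A :
  @convex_set R 'rV[R]_n A -> @convex_set R 'rV[R]_n (closure A).
Proof.
move=> /convex_setP cA; apply/convex_setP => x y t cx cy /andP[t0 t1].
apply/closure_enormP => r r0.
have [x' Ax' xx'] := (closure_enormP _ _).1 cx _ r0.
have [y' Ay' yy'] := (closure_enormP _ _).1 cy _ r0.
exists (t *: x' + (1 - t) *: y'); first by apply: cA => //; rewrite t0 t1.
have -> : t *: x' + (1 - t) *: y' - (t *: x + (1 - t) *: y)
        = t *: (x' - x) + (1 - t) *: (y' - y).
  by rewrite !scalerBr addrACA -opprD.
apply: le_lt_trans (enormD _ _) _; rewrite !enormZ !ger0_norm ?subr_ge0 //.
(* Strictness needs a positive weight; at [t = 0] it comes from [y'] instead of [x']. *)
have [->|tn0] := eqVneq t 0; first by rewrite mul0r subr0 mul1r add0r.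
have : t * enorm (x' - x) < t * r by rewrite ltr_pM2l // lt_neqAle eq_sym tn0.
have : (1 - t) * enorm (y' - y) <= (1 - t) * r.
  by apply: ler_wpM2l; [rewrite subr_ge0|exact: ltW].
lra.
Qed.

Lemma convex_clco A : @convex_set R 'rV[R]_n (clco A).
Proof.
apply: convex_closure; apply/convex_setP => x y t hx hy t01 B [/= cB AB].
by move/convex_setP : (cB); apply => //; [exact: hx|exact: hy].
Qed.

Lemma closed_clco A : closed (clco A).
Proof. exact: closed_closure. Qed.

Lemma sub_clco A : A `<=` clco A.
Proof. by move=> x Ax; apply: subset_closure => B [_]; exact. Qed.

Lemma clco_min A B :
  @convex_set R 'rV[R]_n B -> closed B -> A `<=` B -> clco A `<=` B.
Proof.
move=> cB /closure_id clB AB; rewrite clB; apply: closureS => x; exact.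
Qed.

(** The separating vector is [p - v], with [p] the projection of [v] on [C]; the inequality
    [0 <= dotv w (c - p)] then yields the gap [dotv w w]. *)
Lemma separation C v : closed C -> @convex_set R 'rV[R]_n C -> C !=set0 ->
  ~ C v -> exists2 w, w != 0 & forall c, C c -> dotv v w + dotv w w <= dotv c w.
Proof.
move=> clC /convex_setP cC [c0 Cc0] Cv.
(* Cutting [C] by the ball around [v] through [c0] gives compactness; points of [C] outside that
   ball are farther from [v] than [p]. *)
have [||p [Cp pv] pmin] := @nearest_point _ _ (C `&` ecball v (enorm (c0 - v))) v.
- by exists c0; split => //=; rewrite /ecball /=.
- rewrite setIC; apply: compact_closedI clC; exact: compact_ecball.
have {}pmin q : C q -> enorm (p - v) <= enorm (q - v).
  move=> Cq; have [qc|qc] := leP (enorm (q - v)) (enorm (c0 - v)).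
    exact: pmin.
  exact: le_trans pv (ltW qc).
exists (p - v).
  by apply: contra_notN Cv; rewrite subr_eq0 => /eqP <-.
move=> c Cc; set w := p - v.
suff : 0 <= dotv w (c - p).
  by rewrite /w !dotvE (dotvC p c) (dotvC v c) (dotvC v p); lra.
rewrite leNgt; apply/negP => g0.
set g := dotv w (c - p) in g0; set q := dotv (c - p) (c - p).
have q0 : 0 <= q by exact: dotvv_ge0.
have qg : 0 < q - g by lra.
(* A step [t] towards [c] changes the squared distance by [2 t g + t^2 q]. This [t] lies in ]0, 1],
   even for [q = 0], and makes the change [t g (1 + t) < 0]. *)
pose t := - g / (q - g).
have t0 : 0 < t by rewrite divr_gt0 // oppr_gt0.
have t1 : t <= 1 by rewrite ler_pdivrMr // mul1r; lra.
have tqg : t * (q - g) = - g by rewrite divfK // gt_eqF.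
have : enorm w <= enorm (w + t *: (c - p)).
  have -> : w + t *: (c - p) = t *: c + (1 - t) *: p - v.
    by apply/rowP => i; rewrite !mxE; ring.
  by apply: pmin; apply: cC => //; rewrite t1 ltW.
move: @g @q @t g0 q0 qg t0 t1 tqg; set d := c - p => g q t g0 q0 qg t0 t1 tqg.
rewrite -ler_sqr ?nnegrE ?enorm_ge0 // !enorm_sqr.
clearbody w d; rewrite dotvDl !dotvDr !dotvZl !dotvZr (dotvC d w) -/g -/q.
have : 0 < t * - g by rewrite mulr_gt0 // oppr_gt0.
have : t * (t * (q - g)) = t * - g by rewrite tqg.
have : 0 <= t * t by rewrite -expr2 sqr_ge0.
nra.
Qed.

End closed_convex_sets.

(** * The product of two Euclidean spaces *)

Section product_space.
Context {R : realType} {n m : nat}.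
Implicit Types (x v : 'rV[R]_n) (y u : 'rV[R]_m) (z : 'rV[R]_(n + m)).

Lemma dotv_row_mx x v y u :
  dotv (row_mx x y) (row_mx v u) = dotv x v + dotv y u.
Proof.
rewrite /dotv big_split_ord /=; congr (_ + _); apply: eq_bigr => i _.
  by rewrite !row_mxEl.
by rewrite !row_mxEr.
Qed.

Lemma enorm_row_mx_ge x y :
  enorm x <= enorm (row_mx x y) /\ enorm y <= enorm (row_mx x y).
Proof.
have := dotvv_ge0 x; have := dotvv_ge0 y.
by split; rewrite ler_sqrt ?dotv_row_mx; lra.
Qed.

Lemma enorm_row_mx_le x y : enorm (row_mx x y) <= enorm x + enorm y.
Proof.
have -> : row_mx x y = row_mx x 0 + row_mx 0 y by rewrite add_row_mx addr0 add0r.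
apply: le_trans (enormD _ _) _.
by rewrite /enorm !dotv_row_mx !dotv0l addr0 add0r.
Qed.

Lemma row_mxB x v y u : row_mx x y - row_mx v u = row_mx (x - v) (y - u).
Proof. by rewrite opp_row_mx add_row_mx. Qed.

End product_space.

(** * Regular and limiting normals *)

Section normals.
Context {R : realType} {N : nat}.
Implicit Types (C : set 'rV[R]_N) (z w : 'rV[R]_N).

(** Trades the two sequences for one accuracy [e]; the converse chooses a normal for each
    [e = 1 / (i + 1)]. *)
Lemma limiting_normalP C z w : limiting_normal C z w <->
  forall e : R, 0 < e -> exists z' w',
    [/\ regular_normal C z' w', enorm (z' - z) < e & enorm (w' - w) < e].
Proof.
split=> [[z_ [w_ [Cz rw zz ww]]] e e0|h].
  have near_e (a : nat -> 'rV[R]_N) (b : 'rV[R]_N) : a i @[i --> \oo] --> b ->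
      \forall i \near \oo, enorm (a i - b) < e.
    move=> /(_ [set y | enorm (y - b) < e]); apply.
    by apply/nbhs_enormP; exists e.
  have [i [hz hw]] : exists i, enorm (z_ i - z) < e /\ enorm (w_ i - w) < e.
    by apply: (@filter_ex _ (\oo)); apply: filterI; exact: near_e.
  by exists (z_ i), (w_ i).
have /choice[zw hzw] : forall i : nat, exists zw : 'rV[R]_N * 'rV[R]_N,
    [/\ regular_normal C zw.1 zw.2, enorm (zw.1 - z) < i.+1%:R^-1 &
        enorm (zw.2 - w) < i.+1%:R^-1].
  move=> i; have [|z' [w' hh]] := h i.+1%:R^-1; first by rewrite invr_gt0.
  by exists (z', w').
exists (fst \o zw), (snd \o zw); split => [i|i||].
- by have [[]] := hzw i.
- by have [] := hzw i.
- by apply: cvg_enormP => i; have [] := hzw i.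
- by apply: cvg_enormP => i; have [] := hzw i.
Qed.

Lemma regular_normalZ C z w (k : R) : 0 < k ->
  regular_normal C z w -> regular_normal C z (k *: w).
Proof.
move=> k0 [Cz h]; split => // e e0.
have := h (e / k) (divr_gt0 e0 k0); apply: filterS => z' hz Cz'.
have := hz Cz'; rewrite dotvZl -ler_pdivlMl // => /le_trans; apply.
by rewrite mulrA (mulrC e).
Qed.

Lemma regular_normal0 C z : C z -> regular_normal C z 0.
Proof.
move=> Cz; split => // e e0; near=> z' => _.
by rewrite dotv0l mulr_ge0 ?enorm_ge0 // ltW.
Unshelve. all: by end_near. Qed.

(** Comparing squared distances to [z] gives [dotv (z - p) (q - p) <= enorm (q - p) ^+ 2 / 2] for
    [q] in [C] near [p]. Since [p] is interior to the ball, cutting by the ball does not matter near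
    [p]. *)
Lemma regular_normal_nearest C c (e : R) z p :
  C p -> enorm (p - c) < e ->
  (forall q, (C `&` ecball c e) q -> enorm (p - z) <= enorm (q - z)) ->
  regular_normal C p (z - p).
Proof.
move=> Cp pc pmin; split => // eps eps0.
apply/nbhs_enormP; exists (Num.min (e - enorm (p - c)) (eps *+ 2)).
  by rewrite lt_min subr_gt0 pc mulrn_wgt0.
move=> q; rewrite lt_min => /andP[qe qeps] Cq.
have : enorm (p - z) <= enorm (q - z).
  apply: pmin; split => //; rewrite /ecball /=.
  by have := enormDB q p c; lra.
have -> : q - z = (q - p) + (p - z) by rewrite addrA subrK.
rewrite -(opprB p z); move: qeps; move: (q - p) (p - z) => d b qeps.
rewrite -ler_sqr ?nnegrE ?enorm_ge0 // !enorm_sqr dotvDl !dotvDr dotvNl.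
rewrite (dotvC d b) -(enorm_sqr d).
by have := enorm_ge0 d; nra.
Qed.

End normals.

(** * Proximal aiming along Euler polygons *)

Section proximal_aiming.
Context {R : realType} {N : nat}.
Variables (C F : set 'rV[R]_N) (c z0 : 'rV[R]_N) (e r B t : R).
Hypotheses (clC : closed (C `&` ecball c e)) (re : r <= e).
Hypotheses (cF : @convex_set R 'rV[R]_N F) (F0 : F !=set0).
Hypotheses (FB : forall f, F f -> enorm f <= B) (t0 : 0 <= t).
Hypotheses (Cz0 : C z0) (z0r : enorm (z0 - c) + (t * B) *+ 2 < r).
Hypothesis aim : forall p w, enorm (p - c) < r -> regular_normal C p w ->
  exists2 f, F f & dotv w f <= 0.

Let B_ge0 : 0 <= B.
Proof. by have [f /FB] := F0; apply: le_trans; exact: enorm_ge0. Qed.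

(* Euler polygon: each step moves in a direction of F making an obtuse angle
   with the vector from the nearest point of C, so by Pythagoras the squared
   distance to C grows by at most (t / K * B)^2 per step. *)
Lemma euler_polygon (K k : nat) : (k <= K)%N -> (0 < K)%N ->
  exists p f, [/\ C p, enorm (p - c) < r, F f &
    enorm (p - (z0 + (k%:R * (t / K%:R)) *: f)) ^+ 2
      <= k%:R * (t / K%:R * B) ^+ 2].
Proof.
move=> kK K0; elim: k kK => [_|k IH kK].
  have [f Ff] := F0; exists z0, f; split => //.
    by apply: le_lt_trans z0r; rewrite lerDl mulrn_wge0 // mulr_ge0.
  by rewrite !mul0r scale0r addr0 subrr enorm0 expr0n.
have [p0 [f [Cp0 p0r Ff p0f]]] := IH (ltnW kK).
set tau := t / K%:R in p0f *.
have tau0 : 0 <= tau by rewrite divr_ge0.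
have ktau : k%:R * tau <= t.
  rewrite mulrCA ler_piMr // ler_pdivrMr ?ltr0n // mul1r ler_nat; exact: ltnW.
set z := z0 + _ in p0f.
have zz0 : enorm (z0 - z) <= t * B.
  rewrite enormB addrAC subrr add0r enormZ ger0_norm ?mulr_ge0 //.
  by rewrite ler_pM ?mulr_ge0 ?enorm_ge0 // FB.
have [||p [Cp _] pmin] := @nearest_point _ _ (C `&` ecball c e) z.
- exists z0; split => //; rewrite /ecball /=.
  by have := mulr_ge0 t0 B_ge0; have := z0r; have := re; lra.
- by apply: subclosed_compact clC (compact_ecball c e) _ => q [].
have in_e q : enorm (q - c) < r -> ecball c e q.
  by move=> qr; apply: ltW; exact: lt_le_trans qr re.
(* The drift from [z0] to [z] and the distance from [z] to [p] are each at most [t * B]: hence the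
   doubling in [z0r]. *)
have pr : enorm (p - c) < r.
  have : enorm (p - z) <= enorm (z0 - z).
    apply: pmin; split => //; apply: in_e.
    by have := mulr_ge0 t0 B_ge0; have := z0r; lra.
  have := enormDB p z c; have := enormDB z z0 c; rewrite (enormB z z0).
  by have := z0r; lra.
have pn : regular_normal C p (z - p).
  by apply: regular_normal_nearest Cp (lt_le_trans pr re) pmin.
have [g Fg wg] := aim _ _ pr pn.
(* The average of all directions used so far, [k] of which are summarized by [f]; convexity keeps it
   in [F], so a single vector describes the whole polygon. *)
exists p, ((k%:R / k.+1%:R) *: f + (1 - k%:R / k.+1%:R) *: g); split => //.
  move/convex_setP : cF; apply => //.
  by rewrite divr_ge0 //= ler_pdivrMr ?ltr0n // mul1r ler_nat.
have -> : p - (z0 + (k.+1%:R * tau) *: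
    ((k%:R / k.+1%:R) *: f + (1 - k%:R / k.+1%:R) *: g))
   = - ((z - p) + tau *: g).
  apply/rowP => i; rewrite /z !mxE.
  by rewrite -(natr1 k); field; rewrite natr1 pnatr_eq0.
rewrite enormN enorm_sqr.
have : enorm (z - p) ^+ 2 <= k%:R * (tau * B) ^+ 2.
  apply: le_trans p0f; rewrite ler_sqr ?nnegrE ?enorm_ge0 // enormB.
  by apply: pmin; split => //; exact: in_e.
have gB : (tau * enorm g) ^+ 2 <= (tau * B) ^+ 2.
  by rewrite ler_sqr ?nnegrE ?mulr_ge0 ?enorm_ge0 // ler_wpM2l // FB.
move: wg gB; move: (z - p) => w wg.
have := mulr_ge0_le0 tau0 wg.
rewrite exprMn !enorm_sqr dotvDl !dotvDr !dotvZl !dotvZr (dotvC g w) -natr1; lra.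
Qed.

(** After all [K] steps the squared error is at most [t^2 B^2 / K], which is below [(eps t)^2] once
    [K >= B^2 / eps^2]. *)
Lemma proximal_aiming (eps : R) : 0 < eps -> exists p f,
  [/\ C p, enorm (p - c) < r, F f & enorm (p - (z0 + t *: f)) <= eps * t].
Proof.
move=> eps0; pose K := (Num.trunc (B ^+ 2 / eps ^+ 2)).+1.
have KB : B ^+ 2 <= K%:R * eps ^+ 2.
  by rewrite -ler_pdivrMr ?exprn_gt0 // ltW // truncnS_gt.
have [p [f [Cp pr Ff pf]]] := @euler_polygon K K (leqnn _) isT.
exists p, f; split => //.
rewrite -ler_sqr ?nnegrE ?enorm_ge0 ?mulr_ge0 // ?(ltW eps0) //.
move: pf; rewrite mulrCA divff ?pnatr_eq0 // mulr1 => /le_trans; apply.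
have -> : K%:R * (t / K%:R * B) ^+ 2 = t ^+ 2 * (B ^+ 2 / K%:R).
  by field; rewrite pnatr_eq0.
by rewrite exprMn mulrC ler_wpM2r ?sqr_ge0 // ler_pdivrMr ?ltr0n // mulrC.
Qed.

End proximal_aiming.

(** * Pseudo strict differentiability versus normals to the graph *)

Section coderivative_criterion.
Context {R : realType} {n m : nat}.
Implicit Types (S H : 'rV[R]_n -> set 'rV[R]_m) (x v w : 'rV[R]_n)
  (y u h : 'rV[R]_m) (z : 'rV[R]_(n + m)).

Lemma setscale_ecball (k : R) :
  0 <= k -> setscale k (ecball 0 1) = ecball (0 : 'rV[R]_m) k.
Proof.
move=> k0; apply/seteqP; split => [q [b b1 <-]|q]; rewrite /ecball /= subr0.
  rewrite enormZ ger0_norm // ler_piMr //.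
  by move: b1; rewrite /ecball /= subr0.
move=> qk; have [k_0|kn0] := eqVneq k 0.
  exists 0; first by rewrite /ecball /= subr0 enorm0.
  rewrite scaler0; apply/esym/enorm_eq0/eqP.
  by rewrite eq_le enorm_ge0 andbT -k_0.
exists (k^-1 *: q); last by rewrite scalerA divff // scale1r.
rewrite /ecball /= subr0 enormZ ger0_norm ?invr_ge0 //.
by rewrite ler_pdivrMl ?mulr1 // lt_neqAle eq_sym kn0.
Qed.

Lemma pseudo_strict_diff_enormP S x y H : pseudo_strict_diff S x y H <->
  forall delta : R, 0 < delta -> exists2 r : R, 0 < r &
  forall a b c, enorm (a - x) < r -> enorm (b - x) < r -> enorm (c - y) < r ->
    S a c -> exists s h, [/\ S b s, H (a - b) h &
      enorm (c - s - h) <= delta * enorm (a - b)].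
Proof.
split=> hS d d0.
  have [U [V [/nbhs_enormP[r1 r10 hU] /nbhs_enormP[r2 r20 hV] h]]] := hS d d0.
  exists (Num.min r1 r2); first by rewrite lt_min r10.
  move=> a b c; rewrite !lt_min => /andP[ax _] /andP[bx _] /andP[_ cy] Sac.
  have [|s Ss [q [k Hk [l hl <-]] <-]] := h a b (hU _ ax) (hU _ bx) c.
    by split => //; exact: hV.
  exists s, k; split => //.
  move: hl; rewrite setscale_ecball ?mulr_ge0 ?enorm_ge0 ?(ltW d0) // /ecball /=.
  have -> : s + (k + l) - s - k = l by apply/rowP => i; rewrite !mxE; ring.
  by rewrite subr0.
have [r r0 h] := hS d d0.
exists [set a | enorm (a - x) < r], [set c | enorm (c - y) < r].
split; [by apply/nbhs_enormP; exists r|by apply/nbhs_enormP; exists r|].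
move=> a b /= ax bx c [Sac cy].
have [s [k [Ss Hk le_d]]] := h _ _ _ ax bx cy Sac.
exists s => //; exists (c - s); last by rewrite subrKC.
exists k => //; exists (c - s - k); last by rewrite subrKC.
by rewrite setscale_ecball ?mulr_ge0 ?enorm_ge0 ?(ltW d0) // /ecball /= subr0.
Qed.

(** Going from [a] to [a - t *: w] gives a graph displacement [(- t w, - (t k + l))] with [k] in
    [H w] and [l] of size [delta * t * enorm w]; testing the normal on it and dividing by [t] gives
    the bound. The radius [r] depends on [delta] only, so it serves all nearby normals at once. *)
Lemma pseudo_strict_diff_normal S x y H :
  (forall (k : R) w, 0 < k -> H (k *: w) = setscale k (H w)) ->
  pseudo_strict_diff S x y H -> forall delta : R, 0 < delta ->
  exists2 r : R, 0 < r & forall z v u w (M : R),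
    enorm (z - row_mx x y) < r -> regular_normal (gph S) z (row_mx v (- u)) ->
    (forall h, H w h -> enorm h <= M) -> forall eps : R, 0 < eps ->
  exists2 h, H w h & dotv u h <= dotv v w + delta * enorm w * enorm u + eps.
Proof.
move=> HZ /pseudo_strict_diff_enormP hS delta delta0.
have [r r0 h] := hS _ delta0; exists (r / 2); first by rewrite divr_gt0.
move=> z v u w M zr [Gz nz] HM eps eps0.
rewrite -(hsubmxK z) in zr nz Gz *.
set a := lsubmx z in zr nz Gz *; set c := rsubmx z in zr nz Gz *.
have Sac : S a c by move: Gz; rewrite /gph /= row_mxKl row_mxKr.
have [ax cy] : enorm (a - x) < r / 2 /\ enorm (c - y) < r / 2.
  by move: zr; rewrite row_mxB; have [] := enorm_row_mx_ge (a - x) (c - y); lra.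
(* [t * L] bounds the graph displacement; the final 1 keeps [L] positive. *)
pose L := enorm w + `|M| + delta * enorm w + 1.
have w0 := enorm_ge0 w.
have dw0 : 0 <= delta * enorm w by rewrite mulr_ge0 // ltW.
have L0 : 0 < L by rewrite /L; have := normr_ge0 M; lra.
have [rho rho0 hn] := (nbhs_enormP _ _).1 (nz (eps / L) (divr_gt0 eps0 L0)).
(* Small enough for [a - t *: w] to stay within [r] of [x] and for the displacement to stay below
   [rho]. *)
pose t := Num.min r rho / (2 * L).
have t0 : 0 < t by rewrite divr_gt0 ?mulr_gt0 // lt_min r0.
have tL : t * L <= r / 2 /\ t * L <= rho / 2.
  have -> : t * L = Num.min r rho / 2 by rewrite /t; field; rewrite gt_eqF.
  by split; rewrite ler_pM2r ?invr_gt0 // ge_min lexx ?orbT.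
have tw : t * enorm w <= t * L.
  by rewrite ler_wpM2l ?(ltW t0) // /L; have := normr_ge0 M; lra.
have [||||s [q [Ss Hq le_d]]] := h a (a - t *: w) c.
- by lra.
- have -> : a - t *: w - x = (a - x) - t *: w by rewrite addrAC.
  apply: le_lt_trans (enormD _ _) _; rewrite enormN enormZ ger0_norm ?(ltW t0) //.
  by move: tL => [? ?]; lra.
- by lra.
- exact: Sac.
move: Hq le_d; rewrite subKr HZ // => -[k Hk <-]; rewrite enormZ ger0_norm ?(ltW t0) //.
set l := c - s - _ => le_d; exists k => //.
have kM : enorm k <= `|M| by apply: le_trans (HM _ Hk) _; exact: ler_norm.
have sE : s - c = - (t *: k + l) by rewrite /l subrKC opprB.
clearbody l.
have zz : enorm (row_mx (a - t *: w) s - row_mx a c) <= t * L.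
  rewrite row_mxB sE addrAC subrr add0r.
  apply: le_trans (enorm_row_mx_le _ _) _; rewrite !enormN.
  have := enormD (t *: k) l; rewrite !enormZ ger0_norm ?(ltW t0) //.
  have : t * enorm k <= t * `|M| by rewrite ler_wpM2l // ltW.
  by rewrite /L !mulrDr; move: le_d t0; lra.
have /hn : enorm (row_mx (a - t *: w) s - row_mx a c) < rho.
  by move: tL => [_]; lra.
rewrite /gph /= row_mxKl row_mxKr => /(_ Ss).
rewrite {1}row_mxB sE [a - _ - a]addrAC subrr add0r dotv_row_mx !dotvE => hle.
have : eps / L * enorm (row_mx (a - t *: w) s - row_mx a c) <= t * eps.
  apply: (@le_trans _ _ (eps / L * (t * L))).
    by rewrite ler_wpM2l // divr_ge0 // ltW.
  by rewrite mulrA (mulrC _ t) -!mulrA mulVf ?mulr1 ?gt_eqF.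
have := dotv_ge u l.
have : enorm u * enorm l <= enorm u * (delta * (t * enorm w)).
  by rewrite ler_wpM2l ?enorm_ge0.
move: hle => /=; rewrite -(ler_pM2l t0 (dotv u k)) !mulrDr; lra.
Qed.

(** Testing a normal in the direction [w = - v] bounds [enorm v ^+ 2] by
    [(kappa + 1) * enorm u * enorm v]; the extra 1 is the [delta] of the estimate. *)
Lemma aubin_normal S x y (kappa : R) : 0 <= kappa ->
  pseudo_strict_diff S x y (fun w => setscale (kappa * enorm w) (ecball 0 1)) ->
  exists2 r : R, 0 < r & forall z v u, enorm (z - row_mx x y) < r ->
    regular_normal (gph S) z (row_mx v (- u)) ->
    enorm v <= (kappa + 1) * enorm u.
Proof.
move=> k0 hS; have [|r r0 hr] := pseudo_strict_diff_normal _ _ _ _ _ hS _ ltr01.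
  move=> t w t0; rewrite enormZ ger0_norm ?(ltW t0) //.
  apply/seteqP; split => [q [b bb <-]|q [_ [b bb <-] <-]].
    exists ((kappa * enorm w) *: b); first by exists b.
    by rewrite scalerA; congr (_ *: _); ring.
  by exists b => //; rewrite scalerA; congr (_ *: _); ring.
exists r => // z v u zr nv.
have [->|v0] := eqVneq v 0; first by rewrite enorm0 mulr_ge0 ?addr_ge0 ?enorm_ge0.
have vp := enorm_gt0 _ v0.
rewrite -(ler_pM2r vp); apply/ler_addgt0Pr => eps eps0.
have kv : 0 <= kappa * enorm (- v) by rewrite mulr_ge0 ?enorm_ge0.
have kball h : setscale (kappa * enorm (- v)) (ecball 0 1) h ->
    enorm h <= kappa * enorm (- v).
  by rewrite setscale_ecball // /ecball /= subr0.
have [h /kball hk] := hr z v u (- v) _ zr nv kball _ eps0.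
rewrite enormN dotvNr -enorm_sqr in hk *.
have := dotv_ge u h.
have : enorm u * enorm h <= enorm u * (kappa * enorm v).
  by rewrite ler_wpM2l ?enorm_ge0.
lra.
Qed.

(** Settles the direction [u = 0], for which half-balls [alpha <= dotv u h] are meaningless. Nearby
    normals satisfy the linear bound, which passes to the limit. *)
Lemma aubin_coderivative0 S x y v :
  aubin S x y -> coderivative S x y 0 v -> v = 0.
Proof.
move=> [k k0 /(aubin_normal _ _ _ _ k0)[r r0 h]] /limiting_normalP hn.
apply: enorm_eq0; apply/eqP; rewrite eq_le enorm_ge0 andbT.
apply/ler_addgt0Pr => e e0; rewrite add0r.
have [|z' [w' [nw' zr']]] := hn (Num.min r (e / (k + 2))).
  by rewrite lt_min r0 divr_gt0 //; lra.
rewrite lt_min => /andP[_].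
move: zr' nw'; rewrite lt_min => /andP[zr _].
rewrite -(hsubmxK w'); set a := lsubmx w'; set b := rsubmx w'.
rewrite -{1}(opprK b) => /(h _ _ _ zr); rewrite enormN row_mxB oppr0 subr0 => ab.
rewrite ltr_pdivlMr; last by lra.
have [] := enorm_row_mx_ge (a - v) b.
have := enormD (v - a) a; rewrite subrK enormB.
by move: ab; move: (enorm _) (enorm _) (enorm _) (enorm _) => *; nra.
Qed.

(** Compactness: otherwise normals violating the bound accumulate at the reference point, their
    bounded components [v] cluster at an element of the coderivative at [u0], and that element
    contradicts the strict gap. *)
Lemma coderivative_gap S x y u0 w0 (r0 M alpha : R) : 0 < r0 ->
  (forall z v u, enorm (z - row_mx x y) < r0 ->
    regular_normal (gph S) z (row_mx v (- u)) -> enorm v <= M * enorm u) ->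
  (forall v, coderivative S x y u0 v -> alpha < dotv v w0) ->
  exists2 r : R, 0 < r & forall z v u, enorm (z - row_mx x y) < r ->
    regular_normal (gph S) z (row_mx v (- u)) -> enorm (u - u0) < r ->
    alpha <= dotv v w0.
Proof.
move=> r0_gt0 hM gap; apply: contrapT => /forall2NP nr.
have /choice[q hq] : forall i : nat,
    exists q : 'rV[R]_(n + m) * ('rV[R]_n * 'rV[R]_m),
    [/\ enorm (q.1 - row_mx x y) < Num.min r0 i.+1%:R^-1,
        regular_normal (gph S) q.1 (row_mx q.2.1 (- q.2.2)),
        enorm (q.2.2 - u0) < Num.min r0 i.+1%:R^-1 & dotv q.2.1 w0 < alpha].
  move=> i; have [|] := nr (Num.min r0 i.+1%:R^-1).
    by rewrite lt_min r0_gt0 invr_gt0 ltr0n.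
  move=> /existsNP[z /existsNP[v /existsNP[u /not_implyP[zr]]]].
  move=> /not_implyP[nv /not_implyP[ur /negP]]; rewrite -ltNge => av.
  by exists (z, (v, u)).
pose v_ i := (q i).2.1.
have vM : forall i, ecball 0 (`|M| * (enorm u0 + r0)) (v_ i).
  move=> i; have [] := hq i; rewrite !lt_min => /andP[zr _] nv /andP[ur _] _.
  rewrite /ecball /= subr0; apply: le_trans (hM _ _ _ zr nv) _.
  apply: (@le_trans _ _ (`|M| * enorm (q i).2.2)).
    by rewrite ler_wpM2r ?enorm_ge0 // ler_norm.
  rewrite ler_wpM2l //; have := enormD ((q i).2.2 - u0) u0; rewrite subrK.
  by move: ur; lra.
have [v clv] : exists v : 'rV[R]_n, cluster (v_ @ \oo) v.
  have [|v [_ clv]] := @compact_ecball R n 0 (`|M| * (enorm u0 + r0)) (v_ @ \oo) _.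
    by exists 0%N => // i _; exact: vM.
  by exists v.
(* Testing the cluster point on the image of a tail gives one index both large and close to [v],
   without extracting a subsequence. *)
have appr (e : R) : 0 < e -> exists i, i.+1%:R^-1 < e /\ enorm (v_ i - v) < e.
  move=> e0; have [||_ [[i ie <-] ve]] := clv
    (v_ @` [set i | i.+1%:R^-1 < e]) [set a | enorm (a - v) < e].
  - have := near_infty_natSinv_lt (PosNum e0); apply: filterS => i /= ie.
    by exists i.
  - by apply/nbhs_enormP; exists e.
  by exists i.
have : coderivative S x y u0 v.
  apply/limiting_normalP => e e0; have e20 : 0 < e / 2 by rewrite divr_gt0.
  have [i [ie ve]] := appr _ e20.
  have [] := hq i; rewrite !lt_min => /andP[_ /lt_trans/(_ ie) zr] nv.
  move=> /andP[_ /lt_trans/(_ ie) ur] _.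
  exists (q i).1, (row_mx (q i).2.1 (- (q i).2.2)); split => //; first by lra.
  rewrite row_mxB -opprD; apply: le_lt_trans (enorm_row_mx_le _ _) _.
  by rewrite enormN [ltRHS]splitr; exact: ltrD.
move=> /gap av.
have [|i [_ vi]] := appr ((dotv v w0 - alpha) / (enorm w0 + 1)).
  by rewrite divr_gt0 ?subr_gt0 // ltr_pwDr ?enorm_ge0.
have [_ _ _] := hq i; rewrite -/(v_ i).
move: vi; rewrite ltr_pdivlMr; last by rewrite ltr_pwDr ?enorm_ge0.
have := dotv_ge (v_ i - v) w0; rewrite dotvDl dotvNl.
by have := enorm_ge0 (v_ i - v); lra.
Qed.

(** Proximal aiming from [(a, c)] during time [t] reaches a graph point [(a', c')] close to
    [(b, c - t h)]; the Aubin property then moves its first coordinate to exactly [b]. *)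
Lemma directional_diff S x y (kappa : R) (D : set 'rV[R]_m) w0 (r M : R) :
  locally_closed S x y -> 0 <= kappa ->
  pseudo_strict_diff S x y (fun w => setscale (kappa * enorm w) (ecball 0 1)) ->
  @convex_set R 'rV[R]_m D -> D !=set0 -> (forall h, D h -> enorm h <= M) ->
  w0 != 0 -> 0 < r ->
  (forall z v u, enorm (z - row_mx x y) < r ->
    regular_normal (gph S) z (row_mx v (- u)) ->
    exists2 h, D h & dotv u h <= dotv v w0) ->
  forall delta : R, 0 < delta -> exists2 rho : R, 0 < rho &
  forall a b c (t : R), enorm (a - x) < rho -> enorm (b - x) < rho ->
    enorm (c - y) < rho -> S a c -> 0 < t -> a - b = t *: w0 ->
  exists s h, [/\ S b s, D h & enorm (c - s - t *: h) <= delta * enorm (a - b)].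
Proof.
move=> [e e0 clS] k0 hS cD D0 DM w00 r_gt0 aim delta delta0.
have [r1 r10 hr1] := (pseudo_strict_diff_enormP _ _ _ _).1 hS _ ltr01.
pose r' := Num.min r (Num.min e r1).
have r'0 : 0 < r' by rewrite !lt_min r_gt0 e0.
have [r'r r'e r'1] : [/\ r' <= r, r' <= e & r' <= r1].
  by split; rewrite !ge_min lexx ?orbT.
pose W := enorm w0; have W0 : 0 < W by exact: enorm_gt0.
pose F : set 'rV[R]_(n + m) := [set row_mx (- w0) (- h) | h in D].
pose B := W + M.
have FB f : F f -> enorm f <= B.
  move=> [h Dh <-]; apply: le_trans (enorm_row_mx_le _ _) _.
  by rewrite !enormN lerD2l DM.
have F0 : F !=set0 by have [h Dh] := D0; exists (row_mx (- w0) (- h)); exists h.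
have B0 : 0 <= B by have [f /FB] := F0; apply: le_trans; exact: enorm_ge0.
have cF : @convex_set R 'rV[R]_(n + m) F.
  apply/convex_setP => _ _ t [h Dh <-] [h' Dh' <-] t01.
  exists (t *: h + (1 - t) *: h'); first by move/convex_setP : cD; apply.
  rewrite !scale_row_mx add_row_mx; congr row_mx.
    by rewrite -scalerDl subrKC scale1r.
  by rewrite opprD -!scalerN.
(* The start lies within [2 rho] of the reference point and [t * W < 2 rho], so aiming needs
   [rho * (2 + 4 * B / W)] within [r']; 3 leaves slack. *)
pose L := 3 + 4 * B / W.
have BW : 0 <= B / W by rewrite divr_ge0 // ltW.
have L3 : 3 <= L by rewrite /L -mulrA; lra.
pose rho := r' / L.
have rho0 : 0 < rho by rewrite divr_gt0 //; lra.
have rhoL : rho * L = r' by rewrite /rho divfK // gt_eqF //; lra.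
exists rho => // a b c t ax bx cy Sac t0 abt.
have tW : t * W < 2 * rho.
  have := enormDB a x b; rewrite abt enormZ ger0_norm ?(ltW t0) // (enormB x b) -/W.
  by lra.
have tB : t * B <= 2 * rho * (B / W).
  rewrite mulrA ler_pdivlMr // mulrAC ler_wpM2r //; exact: ltW.
(* With aiming error [eps * t], the second coordinate costs [eps * t] and the Aubin correction
   [(kappa + 1) * eps * t]: hence the divisor [kappa + 2]. *)
have [||||p [f [Gp pr [h Dh hf] pf]]] := @proximal_aiming R (n + m) (gph S) F
    (row_mx x y) (row_mx a c) e r' B t clS r'e cF F0 FB (ltW t0) _ _ _
    (delta * W / (kappa + 2)) _.
- by rewrite /gph /= row_mxKl row_mxKr.
- rewrite row_mxB; have := enorm_row_mx_le (a - x) (c - y).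
  by move: rhoL; rewrite /L mulrDr -mulrA; lra.
- move=> p w pr nw; rewrite -(hsubmxK w) -{1}(opprK (rsubmx w)) in nw *.
  have [h Dh le_h] := aim _ _ _ (lt_le_trans pr r'r) nw.
  exists (row_mx (- w0) (- h)); first by exists h.
  rewrite -(opprK (rsubmx w)) dotv_row_mx !dotvNr dotvNl opprK; lra.
- by rewrite divr_gt0 ?mulr_gt0 //; lra.
move: Gp pr pf; rewrite -(hsubmxK p) -hf.
set a' := lsubmx p; set c' := rsubmx p.
rewrite /gph /= row_mxKl row_mxKr scale_row_mx add_row_mx !row_mxB => Sp pr pf.
have ab : a + t *: - w0 = b by rewrite scalerN -abt subKr.
rewrite ab scalerN in pf.
set eps := delta * W / (kappa + 2) in pf.
have epsE : eps * (kappa + 2) = delta * W by rewrite /eps divfK // gt_eqF //; lra.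
have [a'b c'c] := enorm_row_mx_ge (a' - b) (c' - (c - t *: h)).
have [a'x c'y] := enorm_row_mx_ge (a' - x) (c' - y).
have [||||s [q [Ss Hq le_q]]] := hr1 a' b c'.
- by lra.
- have : rho * 1 <= rho * L by rewrite ler_wpM2l ?(ltW rho0) //; lra.
  by lra.
- by lra.
- exact: Sp.
move: Hq; rewrite setscale_ecball ?mulr_ge0 ?enorm_ge0 // /ecball /= subr0 => qk.
exists s, h; split => //.
have -> : c - s - t *: h = (c' - s - q) + q - (c' - (c - t *: h)).
  by apply/rowP => i; rewrite !mxE; ring.
rewrite abt enormZ ger0_norm ?(ltW t0) // -/W.
have := enormD (c' - s - q + q) (- (c' - (c - t *: h))).
have := enormD (c' - s - q) q; rewrite enormN.
have : kappa * enorm (a' - b) <= kappa * (eps * t) by rewrite ler_wpM2l //; lra.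
have : eps * (kappa + 2) * t = delta * W * t by rewrite epsE.
lra.
Qed.

End coderivative_criterion.

(** * A prefan prescribed on a single ray *)

Section ray_prefan.
Context {R : realType} {n m : nat}.
Variables (w0 : 'rV[R]_n) (D : set 'rV[R]_m) (kappa : R).

(** The test detects positive multiples of [w0], with factor [enorm w / enorm w0]; [w = 0] would
    pass the equality and is sent to the degenerate ball. Prefans need no continuity between
    directions, so one ray can be altered alone. *)
Definition ray_map (w : 'rV[R]_n) : set 'rV[R]_m :=
  if (w != 0) && (w == (enorm w / enorm w0) *: w0)
  then setscale (enorm w / enorm w0) D else ecball 0 (kappa * enorm w).

Hypotheses (w0_neq0 : w0 != 0) (kappa_ge0 : 0 <= kappa).

Let w0_gt0 : 0 < enorm w0.
Proof. exact: enorm_gt0. Qed.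

Lemma ray_map_scale (t : R) : 0 < t -> ray_map (t *: w0) = setscale t D.
Proof.
move=> t0; rewrite /ray_map scaler_eq0 negb_or w0_neq0 (gt_eqF t0) enormZ.
by rewrite ger0_norm ?(ltW t0) // mulfK ?gt_eqF // eqxx.
Qed.

Lemma ray_mapZ (k : R) w : 0 < k -> ray_map (k *: w) = setscale k (ray_map w).
Proof.
move=> k0; rewrite /ray_map scaler_eq0 gt_eqF //= enormZ ger0_norm ?(ltW k0) //.
rewrite -mulrA -scalerA (inj_eq (scalerI (lt0r_neq0 k0))).
case: ifP => _; apply/seteqP; split.
- by move=> q [h Dh <-]; exists ((enorm w / enorm w0) *: h);
    [exists h|rewrite scalerA].
- by move=> q [_ [h Dh <-] <-]; exists h; rewrite ?scalerA.
- move=> q; rewrite /ecball /= subr0 => hq; exists (k^-1 *: q).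
    rewrite /ecball /= subr0 enormZ ger0_norm ?invr_ge0 ?(ltW k0) //.
    by rewrite ler_pdivrMl // mulrCA.
  by rewrite scalerA divff ?scale1r // gt_eqF.
- move=> _ [h hh <-]; move: hh; rewrite /ecball /= !subr0 enormZ.
  by rewrite ger0_norm ?(ltW k0) // (mulrCA kappa) ler_pM2l.
Qed.

Lemma setscale_compact (t : R) : compact D -> compact (setscale t D).
Proof.
move=> cD; have -> : setscale t D = (fun h : 'rV[R]_m => t *: h) @` D by [].
by apply: continuous_compact => //; apply: continuous_subspaceT => x;
  exact: scaler_continuous.
Qed.

Lemma setscale_convex (t : R) :
  @convex_set R 'rV[R]_m D -> @convex_set R 'rV[R]_m (setscale t D).
Proof.
move=> /convex_setP cD; apply/convex_setP => _ _ s [h Dh <-] [h' Dh' <-] s01.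
exists (s *: h + (1 - s) *: h'); first exact: cD.
by apply/rowP => i; rewrite !mxE; ring.
Qed.

Lemma ray_map_prefan (K : R) : D !=set0 -> @convex_set R 'rV[R]_m D ->
  compact D -> (forall h, D h -> enorm h <= K) -> prefan ray_map.
Proof.
move=> D0 cD kD DK.
have K0 : 0 <= K by have [h /DK] := D0; apply: le_trans; exact: enorm_ge0.
have H00 : ray_map 0 0.
  by rewrite /ray_map eqxx /= /ecball /= subrr !enorm0 mulr0.
split.
- by split => // k w k0; rewrite ray_mapZ.
- move=> p; rewrite /ray_map; case: ifP => _.
    split; last exact: setscale_compact.
      by have [h Dh] := D0; exists ((enorm p / enorm w0) *: h); exists h.
    exact: setscale_convex.
  split; [|exact: convex_ecball|exact: compact_ecball].
  by exists 0; rewrite /ecball /= subrr enorm0 mulr_ge0 ?enorm_ge0.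
(* The value 0 at 0 excludes minus infinity; above, [K / enorm w0] bounds the ray and [kappa] the
   other directions. *)
- have on0 : (0 <= outer_norm ray_map)%E.
    apply: (@le_trans _ _ (ereal_sup [set (enorm z)%:E | z in ray_map 0])).
      by apply: ereal_sup_ubound; exists 0 => //; rewrite enorm0.
    by apply: ereal_sup_ubound; exists 0 => //=; rewrite enorm0.
  rewrite ge0_fin_numE //.
  apply: (@le_lt_trans _ _ (K / enorm w0 + kappa)%:E); last exact: ltry.
  apply: ge_ereal_sup => _ [w /= w1 <-]; apply: ge_ereal_sup => _ [z hz <-].
  have Kw : 0 <= K / enorm w0 by rewrite divr_ge0 ?enorm_ge0.
  rewrite lee_fin; move: hz; rewrite /ray_map; case: ifP => _.
    move=> [h Dh <-]; rewrite enormZ ger0_norm ?divr_ge0 ?enorm_ge0 //.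
    have hK : enorm h / enorm w0 <= K / enorm w0.
      by rewrite ler_pM2r ?invr_gt0 // DK.
    have hw : 0 <= enorm h / enorm w0 by rewrite divr_ge0 ?enorm_ge0.
    rewrite mulrAC -mulrA; apply: (@le_trans _ _ (1 * (enorm h / enorm w0))).
      by rewrite ler_wpM2r.
    by move: kappa_ge0; lra.
  rewrite /ecball /= subr0 => /le_trans; apply.
  by apply: (@le_trans _ _ (kappa * 1)); [rewrite ler_wpM2l|lra].
Qed.

(** Each pair [a], [b] involves the map at [a - b] only: on the ray the directional estimate
    applies, elsewhere the Aubin one. *)
Lemma ray_map_pseudo_strict_diff (S : 'rV[R]_n -> set 'rV[R]_m) x y :
  pseudo_strict_diff S x y (fun w => setscale (kappa * enorm w) (ecball 0 1)) ->
  (forall delta : R, 0 < delta -> exists2 rho : R, 0 < rho &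
    forall a b c (t : R), enorm (a - x) < rho -> enorm (b - x) < rho ->
      enorm (c - y) < rho -> S a c -> 0 < t -> a - b = t *: w0 ->
    exists s h, [/\ S b s, D h &
      enorm (c - s - t *: h) <= delta * enorm (a - b)]) ->
  pseudo_strict_diff S x y ray_map.
Proof.
move=> /pseudo_strict_diff_enormP hS hD; apply/pseudo_strict_diff_enormP => d d0.
have [r1 r10 h1] := hS d d0; have [r2 r20 h2] := hD d d0.
exists (Num.min r1 r2); first by rewrite lt_min r10.
move=> a b c; rewrite !lt_min => /andP[a1 a2] /andP[b1 b2] /andP[c1 c2] Sac.
rewrite /ray_map; case: ifP => [/andP[ab0 /eqP abE]|_].
  have t0 : 0 < enorm (a - b) / enorm w0 by rewrite divr_gt0 // enorm_gt0.
  have [s [h [Ss Dh le_h]]] := h2 _ _ _ _ a2 b2 c2 Sac t0 abE.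
  by exists s, ((enorm (a - b) / enorm w0) *: h); split => //; exists h.
have [s [h [Ss Dh le_h]]] := h1 _ _ _ a1 b1 c1 Sac.
by exists s, h; split => //; rewrite -setscale_ecball // mulr_ge0 ?enorm_ge0.
Qed.

End ray_prefan.

(** * Half-balls and their support in all directions *)

Section half_ball.
Context {R : realType} {m : nat}.
Variables (u0 : 'rV[R]_m) (alpha : R).

(** The half-space carries the separating inequality; the ball makes it compact, as values of a
    prefan must be. *)
Definition half_ball (K : R) : set 'rV[R]_m :=
  [set h | alpha <= dotv u0 h] `&` ecball 0 K.

Lemma half_ball_convex (K : R) : @convex_set R 'rV[R]_m (half_ball K).
Proof.
apply/convex_setP => a b t [/= ha Ka] [/= hb Kb] /[dup] t01 /andP[t0 t1].
split => /=; last by move/convex_setP : (@convex_ecball R m 0 K); apply.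
have := ler_wpM2l t0 ha; have t1' : 0 <= 1 - t by rewrite subr_ge0.
by have := ler_wpM2l t1' hb; rewrite !dotvE; lra.
Qed.

Lemma half_ball_compact (K : R) : compact (half_ball K).
Proof.
rewrite /half_ball setIC; apply: compact_closedI; first exact: compact_ecball.
have -> : [set h | alpha <= dotv u0 h] = dotv u0 @^-1` [set t | alpha <= t] by [].
by apply: closed_comp (@closed_ge _ alpha) => y _; exact: dotv_continuous.
Qed.

(* Near the ray of u0 the flat face of the half-ball already suffices; away from
   it a large radius beats the linear lower bound on c. *)
Lemma half_ball_support (eta M : R) : u0 != 0 -> 0 < eta -> 0 <= M ->
  exists2 K : R, half_ball K !=set0 & forall u (c : R),
    (forall s : R, 0 < s -> enorm (s *: u - u0) < eta -> alpha <= s * c) ->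
    - (M * enorm u) <= c -> exists2 h, half_ball K h & dotv u h <= c.
Proof.
move=> u00 eta0 M0; pose U := enorm u0; have U0 : 0 < U by exact: enorm_gt0.
have UE : dotv u0 u0 = U ^+ 2 by rewrite enorm_sqr.
(* Heights [alpha] or [T] along [u0] and a length up to [L] orthogonally will be combined; [L] is
   what directions far from the ray need, [T] what directions with [s <= 0] need. *)
pose L := `|alpha| / eta + M * (U / eta + 1).
pose T := `|alpha| + M * U.
have MU : 0 <= M * U by rewrite mulr_ge0 // ltW.
have L0 : 0 <= L.
  by rewrite addr_ge0 ?divr_ge0 ?mulr_ge0 ?addr_ge0 ?divr_ge0 // ltW.
have LM : M <= L.
  have : 0 <= `|alpha| / eta by rewrite divr_ge0 // ltW.
  have : 0 <= M * (U / eta) by rewrite mulr_ge0 // divr_ge0 // ltW.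
  by rewrite /L mulrDr; lra.
exists (T / U + L).
  exists ((alpha / U ^+ 2) *: u0); split => /=.
    by rewrite dotvZr UE divfK // expf_neq0 // gt_eqF.
  rewrite /ecball /= subr0 enormZ -/U normrM normfV normrX (ger0_norm (ltW U0)).
  have -> : `|alpha| / U ^+ 2 * U = `|alpha| / U by field; rewrite gt_eqF.
  have : `|alpha| / U <= T / U by rewrite ler_pM2r ?invr_gt0 // /T; lra.
  by lra.
move=> u c near_u0 c_ge.
pose s := dotv u u0 / U ^+ 2; pose e := u - s *: u0.
have uE : u = s *: u0 + e by rewrite subrKC.
have eu0 : dotv e u0 = 0.
  by rewrite /e dotvDl dotvNl dotvZl UE divfK ?subrr // expf_neq0 // gt_eqF.
clearbody e s; pose E := enorm e.
have E0 : 0 <= E by exact: enorm_ge0.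
have uU : M * enorm u <= M * (`|s| * U + E).
  by rewrite ler_wpM2l // uE (le_trans (enormD _ _)) // enormZ.
(* Division by zero is harmless: l / E = 0 when E = 0. *)
pose pt t l := (t / U ^+ 2) *: u0 - (l / E) *: e.
have lE (l : R) : l / E * dotv e e = l * E.
  rewrite -enorm_sqr -/E; have [->|En0] := eqVneq E 0; first by rewrite expr0n !mulr0.
  by rewrite expr2 mulrA divfK.
(* As [e] is orthogonal to [u0], [t] acts only on the part [s] of [u] and [l] only on [E]. *)
have pt_dot t l : dotv u (pt t l) = t * s - l * E.
  rewrite uE /pt !dotvDl !dotvDr !dotvNr !dotvZl !dotvZr UE (dotvC u0 e) eu0 lE.
  by rewrite !mulr0; field; rewrite gt_eqF.
have pt_in t l : alpha <= t -> `|t| <= T -> 0 <= l <= L -> half_ball (T / U + L) (pt t l).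
  move=> at_ tT /andP[l0 lL]; split => /=.
    rewrite /pt dotvDr dotvNr !dotvZr UE (dotvC u0 e) eu0 mulr0 subr0.
    by rewrite divfK // expf_neq0 // gt_eqF.
  rewrite /ecball /= subr0; apply: le_trans (enormD _ _) _.
  rewrite enormN !enormZ -/U -/E; apply: lerD.
    rewrite normrM normfV normrX (ger0_norm (ltW U0)).
    have -> : `|t| / U ^+ 2 * U = `|t| / U by field; rewrite gt_eqF.
    by rewrite ler_pM2r ?invr_gt0.
  rewrite ger0_norm ?divr_ge0 //; have [->|En0] := eqVneq E 0; first by rewrite mulr0.
  by rewrite divfK.
have aT : `|alpha| <= T by rewrite /T; lra.
(* For [s <= 0], [T * s <= M * U * s] and [L >= M] put the value below the linear lower bound on
   [c]. *)
have [s0|s0] := ltP 0 s; last first.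
  exists (pt T L).
    apply: pt_in; [exact: le_trans (ler_norm _) aT| |by rewrite L0 lexx].
    by rewrite ger0_norm // (le_trans _ aT).
  rewrite pt_dot; move: uU c_ge; rewrite (ler0_norm s0) /T.
  have : M * E <= L * E by rewrite ler_wpM2r.
  have : `|alpha| * s <= 0 by rewrite mulr_ge0_le0.
  by move=> ? ? ? ?; lra.
(* Here [s^-1 *: u] is within [eta] of [u0], so [alpha * s <= c]. *)
have [es|es] := ltP E (s * eta).
  exists (pt alpha 0); first by apply: pt_in => //; rewrite lexx L0.
  rewrite pt_dot mul0r subr0 -ler_pdivlMr // mulrC; apply: near_u0.
    by rewrite invr_gt0.
  rewrite uE scalerDr scalerA mulVf ?gt_eqF // scale1r addrAC subrr add0r.
  by rewrite enormZ ger0_norm ?invr_ge0 ?(ltW s0) // ltr_pdivrMl.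
(* Now [s <= E / eta] turns every term in [s] into one in [E], absorbed by [L * E]. *)
exists (pt alpha L); first by apply: pt_in => //; rewrite L0 lexx.
rewrite pt_dot; move: uU c_ge; rewrite (ger0_norm (ltW s0)) => uU c_ge.
have sE : s <= E / eta by rewrite ler_pdivlMr.
have : alpha * s <= `|alpha| * (E / eta).
  apply: (@le_trans _ _ (`|alpha| * s)); first by rewrite ler_pM2r // ler_norm.
  by rewrite ler_wpM2l.
have : M * U * s <= M * U * (E / eta) by rewrite ler_wpM2l.
rewrite /L; lra.
Qed.

End half_ball.

(** * Comparison of the coderivatives *)

Lemma coderivative_sub_clco {R : realType} {n m : nat}
    (S1 S2 : 'rV[R]_n -> set 'rV[R]_m) x1 x2 y1 y2 :
  (0 < n)%N -> gph S2 (row_mx x2 y2) -> locally_closed S2 x2 y2 ->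
  aubin S1 x1 y1 -> aubin S2 x2 y2 ->
  (forall H, prefan H ->
    pseudo_strict_diff S2 x2 y2 H -> pseudo_strict_diff S1 x1 y1 H) ->
  forall u, coderivative S1 x1 y1 u `<=` clco (coderivative S2 x2 y2 u).
Proof.
move=> n_gt0 gph2 closed2 aubin1 aubin2 prefans u0 v0 v0S1.
(* For [u0 = 0] the only candidate is [v0 = 0], which the zero normal at [(x2, y2)] provides. *)
have [u00|u00] := eqVneq u0 0.
  rewrite u00 in v0S1 *; rewrite (aubin_coderivative0 _ _ _ _ aubin1 v0S1).
  apply: sub_clco; apply/limiting_normalP => e e0.
  exists (row_mx x2 y2), 0; rewrite oppr0 row_mx0 !subrr !enorm0.
  by split => //; exact: regular_normal0.
apply: contrapT => v0S2.
have [w0 [alpha [w00 v0a aS2]]] : exists (w0 : 'rV[R]_n) (alpha : R), [/\ w0 != 0,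
    dotv v0 w0 < alpha &
    forall v, coderivative S2 x2 y2 u0 v -> alpha < dotv v w0].
  have [[c cS2]|empty] := pselect (coderivative S2 x2 y2 u0 !=set0).
    have [|w w_0 sep] := separation _ _ (closed_clco _) (convex_clco _) _ v0S2.
      by exists c; exact: sub_clco.
    have ww : 0 < dotv w w by rewrite -enorm_sqr exprn_gt0 // enorm_gt0.
    (* Half of the separation gap makes both inequalities strict. *)
    exists w, (dotv v0 w + dotv w w / 2); split => //; first by lra.
    by move=> v /sub_clco/sep; lra.
  (* With an empty coderivative the lower bound is vacuous: any nonzero [w0] will do, and [0 < n]
     supplies one. *)
  exists (delta_mx 0 (Ordinal n_gt0)), (dotv v0 (delta_mx 0 (Ordinal n_gt0)) + 1).
  split; last by move=> v vS2; exfalso; apply: empty; exists v.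
    apply/eqP => /rowP/(_ (Ordinal n_gt0))/eqP.
    by rewrite !mxE !eqxx /= oner_eq0.
  by rewrite ltrDl.
have [kappa k0 hS2] := aubin2.
have [r0 r00 vu] := aubin_normal _ _ _ _ k0 hS2.
have [r r_gt0 gap] := coderivative_gap _ _ _ _ _ _ _ _ r00 vu aS2.
have W0 := enorm_ge0 w0.
have M0 : 0 <= (kappa + 1) * enorm w0 by rewrite mulr_ge0 // addr_ge0.
have [K D0 hD] := half_ball_support _ alpha _ _ u00 r_gt0 M0.
set D := half_ball u0 alpha K in D0 hD.
have DK h : D h -> enorm h <= K by move=> [_]; rewrite /ecball /= subr0.
have K0 : 0 <= K by have [h /DK] := D0; apply: le_trans; exact: enorm_ge0.
(* Both requirements of [hD] hold for [c = dotv v w0]: normals form a cone, so the gap applies to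
   the normal rescaled by [s], and the Aubin bound gives the linear lower bound. *)
have aim z v u : enorm (z - row_mx x2 y2) < Num.min r0 r ->
    regular_normal (gph S2) z (row_mx v (- u)) ->
    exists2 h, D h & dotv u h <= dotv v w0.
  rewrite lt_min => /andP[zr0 zr] nv; apply: hD => [s s0 su|].
    have := gap _ (s *: v) (s *: u) zr; rewrite dotvZl; apply => //.
    by rewrite -scalerN -scale_row_mx; exact: regular_normalZ.
  have := dotv_ge v w0; have := ler_wpM2r W0 (vu _ _ _ zr0 nv); lra.
have Hprefan := ray_map_prefan _ _ _ w00 k0 _ D0 (half_ball_convex _ _ _)
  (half_ball_compact _ _ _) DK.
have rr0 : 0 < Num.min r0 r by rewrite lt_min r00.
have hdir := directional_diff _ _ _ _ _ _ _ _ closed2 k0 hS2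
  (half_ball_convex _ _ _) D0 DK w00 rr0 aim.
have HS2 : pseudo_strict_diff S2 x2 y2 (ray_map w0 D kappa).
  exact: ray_map_pseudo_strict_diff.
have hS1 := pseudo_strict_diff_normal _ _ _ _ (ray_mapZ w0 D kappa)
  (prefans _ Hprefan HS2).
(* Three errors of [g / 4] arise: the [delta] term, the slack of the estimate, and [e * (W + K)] for
   replacing [(v, u)] by [(v0, u0)]. Their sum stays below [g], a contradiction. *)
pose g := alpha - dotv v0 w0.
have g0 : 0 < g by rewrite subr_gt0.
pose W := enorm w0 + 1; pose U := enorm u0 + 1.
have W1 : 0 < W by rewrite ltr_pwDr.
have U1 : 0 < U by rewrite ltr_pwDr ?enorm_ge0.
have [|r1 r10 h1] := hS1 (g / (4 * (W * U))); first by rewrite divr_gt0 ?mulr_gt0.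
set delta := g / _ in h1.
have deltaE : delta * (W * U) = g / 4.
  by rewrite /delta; field; rewrite !gt_eqF.
have delta0 : 0 < delta by rewrite divr_gt0 ?mulr_gt0.
pose e := g / (4 * (W + K)).
have WK : 0 < W + K by rewrite ltr_wpDr.
have eE : e * (W + K) = g / 4 by rewrite /e; field; rewrite gt_eqF.
have e0 : 0 < e by rewrite divr_gt0 ?mulr_gt0.
have [|z [w' []]] := (limiting_normalP _ _ _).1 v0S1 (Num.min r1 (Num.min 1 e)).
  by rewrite !lt_min r10 ltr01.
rewrite -(hsubmxK w') -{1}(opprK (rsubmx w')).
move: (lsubmx w') => v; rewrite -{2}(opprK (rsubmx w')); move: (- rsubmx w') => u.
rewrite row_mxB opprK (addrC (- u)) => nz; rewrite !lt_min.
move=> /andP[zr _] /and3P[_ vu1 vue].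
have [vv uu] := enorm_row_mx_ge (v - v0) (u0 - u).
have HwK h : ray_map w0 D kappa w0 h -> D h.
  rewrite -{2}(scale1r w0) ray_map_scale // => -[h' Dh' <-].
  by rewrite scale1r.
have [h /HwK Dh le_h] := h1 z v u w0 K zr nz (fun h hh => DK _ (HwK _ hh))
  (g / 4) (divr_gt0 g0 (ltr0n _ 4)).
have [/= ah _] := Dh.
have : dotv (u0 - u) h <= e * K.
  apply: le_trans (dotv_le _ _) _; apply: ler_pM; rewrite ?enorm_ge0 ?DK //.
  by lra.
have : dotv (v - v0) w0 <= e * W.
  apply: le_trans (dotv_le _ _) _; apply: ler_pM; rewrite ?enorm_ge0 //; rewrite /W; lra.
have : delta * enorm w0 * enorm u <= delta * W * U.
  have := enormDB u u0 0; rewrite !subr0 enormB => uU.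
  apply: ler_pM; [|exact: enorm_ge0| |by rewrite /U; lra].
    by rewrite mulr_ge0 // ltW.
  by rewrite ler_pM2l // /W; lra.
rewrite !dotvDl !dotvNl; move: eE deltaE; rewrite mulrDr mulrA /g in le_h *; lra.
Qed.

Theorem theorem5p8 (R : realType) (n m : nat) (n_gt0 : (0 < n)%N)
  (S1 S2 : 'rV[R]_n -> set 'rV[R]_m)
  (x1 x2 : 'rV[R]_n) (y1 y2 : 'rV[R]_m)
  (gph1 : gph S1 (row_mx x1 y1)) (gph2 : gph S2 (row_mx x2 y2))
  (closed1 : locally_closed S1 x1 y1) (closed2 : locally_closed S2 x2 y2)
  (aubin1 : aubin S1 x1 y1) (aubin2 : aubin S2 x2 y2)
  (same_prefans : forall H : 'rV[R]_n -> set 'rV[R]_m, prefan H ->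
     (pseudo_strict_diff S1 x1 y1 H <-> pseudo_strict_diff S2 x2 y2 H)) :
  forall u : 'rV[R]_m,
    convexified_coderivative S1 x1 y1 u = convexified_coderivative S2 x2 y2 u.
Proof.
(* The hulls are closed and convex, so each inclusion reduces to the coderivative itself; the maps
   then exchange roles. *)
move=> u; apply/seteqP; split; apply: clco_min;
  [exact: convex_clco|exact: closed_clco| |exact: convex_clco|exact: closed_clco|].
- by apply: coderivative_sub_clco => // H /same_prefans[].
- by apply: coderivative_sub_clco => // H /same_prefans[].
Qed.
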